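(* Let $\mathcal{C}$ be a 2-partitionable clutter on $2d$ vertices with incidence matrix $A$. If there exists a minimal vertex cover $C$ of $\mathcal{C}$ such that $|C|=d\geq 3$, and $\mathcal{C}$ satisfies the König property, then $\operatorname{rank}(A)=d+1$.
   Context: A clutter is a hypergraph (finite vertex set $V$ with a collection $E$ of subsets of $V$, called edges) in which no edge is contained in another distinct edge. A hypergraph $(V,E)$ with $|V|=2d$, $d\ge 2$, is 2-partitionable if there is a partition $V=X_1\cup\cdots\cup X_d$ into $d$ subsets of size two such that $|S\cap X_j|=1$ for every edge $S\in E$ and every $j$. The incidence matrix $A$ is the $\{0,1\}$-matrix whose columns are the characteristic vectors of the edges. A vertex cover is a set of vertices meeting every edge; it is minimal if no proper subset is a vertex cover. The König property means $\tau(\mathcal{C})=\nu(\mathcal{C})$, where $\tau(\mathcal C)$ is the minimum size of a vertex cover and $\nu(\mathcal C)$ is the maximum number of pairwise disjoint edges. *)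

(* Defs.v *)
From mathcomp Require Import all_boot all_order all_algebra.

Set Implicit Arguments.
Unset Strict Implicit.
Unset Printing Implicit Defensive.

(* A hypergraph is given by its set of edges E : {set {set T}}; its vertex set
   is the whole finite type T. *)

Definition clutter (T : finType) (E : {set {set T}}) : Prop :=
  forall S S' : {set T}, S \in E -> S' \in E -> S \subset S' -> S = S'.

Definition two_partitionable (T : finType) (d : nat) (E : {set {set T}}) : Prop :=
  [/\ #|T| = 2 * d, 2 <= d &
    exists P : {set {set T}},
      [/\ partition P [set: T], #|P| = d,
          (forall X : {set T}, X \in P -> #|X| = 2) &
          (forall S X : {set T}, S \in E -> X \in P -> #|S :&: X| = 1)]].

Definition incidence_mx (T : finType) (E : {set {set T}}) : 'M[rat]_(#|T|, #|E|) :=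
  (\matrix_(i, j) ((enum_val i : T) \in (enum_val j : {set T}))%:R)%R.

Definition vertex_cover (T : finType) (E : {set {set T}}) (C : {set T}) : bool :=
  [forall S in E, C :&: S != set0].

Definition minimal_vertex_cover (T : finType) (E : {set {set T}}) (C : {set T}) :
  bool := minset (vertex_cover E) C.

(* If set0 \in E there is no vertex cover, and the value is junk; this cannot
   happen for a two_partitionable hypergraph. *)
Definition covering_number (T : finType) (E : {set {set T}}) : nat :=
  #|[arg min_(C < [set: T] | vertex_cover E C) #|C|]|.

Definition matching_number (T : finType) (E : {set {set T}}) : nat :=
  \max_(M : {set {set T}} | (M \subset E) && trivIset M) #|M|.

Definition konig (T : finType) (E : {set {set T}}) : Prop :=
  covering_number E = matching_number E.

(* Main.v *)
Require Import Defs.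
From mathcomp Require Import all_boot all_order all_algebra.

(** Every edge contains exactly one vertex of each block, so the rows of the two
    vertices of a block add up to the all-ones row. A minimal cover C with d >= 3
    elements contains no block (blocks are covers), hence is a transversal of
    the blocks, and the row space of the incidence matrix is spanned by the
    all-ones row and the d rows indexed by C. These are linearly independent:
    minimality of C gives for each c in C an edge meeting C in c only, so that in
    a relation all coefficients on C equal minus the coefficient a of the
    all-ones row. No vertex lies in all of these private edges, so the covering
    number is at least 2, and the König property provides two disjoint edges;
    these partition C, and adding the relations they give yields a * (2 - d) = 0. *)

Set Implicit Arguments.
Unset Strict Implicit.
Unset Printing Implicit Defensive.

Import GRing.Theory Num.Theory.

Lemma vertex_coverP (T : finType) (E : {set {set T}}) (C : {set T}) :
  reflect (forall S, S \in E -> exists2 x, x \in C & x \in S) (vertex_cover E C).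
Proof.
apply: (iffP forall_inP) => [cC S /cC /set0Pn [x /setIP [xC xS]]|cC S /cC [x xC xS]].
  by exists x.
by apply/set0Pn; exists x; rewrite inE xC.
Qed.

(** By minimality [C :\ c] misses some edge; [C] still meets that edge, so it can do so only in
    [c]. *)
Lemma minimal_cover_private_edge (T : finType) (E : {set {set T}}) (C : {set T}) c :
  minimal_vertex_cover E C -> c \in C ->
  exists2 S, S \in E & {in C, forall x, (x \in S) = (x == c)}.
Proof.
move=> /minsetP [/vertex_coverP covC minC] cC.
have /forall_inPn [S SE /negPn /eqP dS] : ~~ vertex_cover E (C :\ c).
  apply/negP => /minC /(_ (subsetDl _ _)) /setP /(_ c).
  by rewrite !inE eqxx cC.
have xS x : x \in C -> x \in S -> x = c.
  move=> xC xS; apply/eqP/negPn/negP => nxc.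
  by move/setP: dS => /(_ x); rewrite !inE nxc xC xS.
exists S => // x xC; apply/idP/eqP => [/xS -> //|->].
by have [y yC yS] := covC S SE; rewrite -(xS y yC yS).
Qed.

(** Restates the block condition as complementation of two vertices, the form in which the rank
    computation uses it. *)
Lemma partner_exists (T : finType) (E : {set {set T}}) (X : {set T}) x :
  #|X| = 2 -> (forall S, S \in E -> #|S :&: X| = 1) -> x \in X ->
  exists y, X = [set x; y] /\ {in E, forall S : {set T}, (y \in S) = (x \notin S)}.
Proof.
move=> X2 EX xX.
have [y [nxy eX]] : exists y, x != y /\ X = [set x; y].
  have /eqP/cards2P [a [b [nab eX]]] := X2.
  move: xX; rewrite eX !inE => /orP [] /eqP ->; first by exists b.
  by exists a; rewrite eq_sym setUC.
exists y; split=> // S /EX; rewrite eX setIUr cardsU.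
have -> : S :&: [set x] :&: (S :&: [set y]) = set0.
  apply/setP => z; rewrite !inE; case: eqP => [->|]; rewrite ?andbF //.
  by rewrite (negPf nxy) !andbF.
rewrite cards0 subn0.
have cI z : #|S :&: [set z]| = (z \in S).
  case: (boolP (z \in S)) => zS; first by rewrite (setIidPr _) ?cards1 ?sub1set.
  by apply: eq_card0 => u; rewrite !inE; case: eqP => [->|]; rewrite ?(negPf zS) ?andbF.
by rewrite !cI; case: (x \in S); case: (y \in S).
Qed.

Lemma minimal_cover_transversal (T : finType) (E P : {set {set T}}) (C : {set T}) :
  partition P [set: T] -> (forall X, X \in P -> #|X| = 2) ->
  (forall S X : {set T}, S \in E -> X \in P -> #|S :&: X| = 1) ->
  minimal_vertex_cover E C -> #|C| = #|P| -> 3 <= #|C| ->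
  forall X, X \in P -> #|C :&: X| = 1.
Proof.
move=> /and3P [/eqP covP trivP _] P2 EP /minsetP [covC minC] CP C3.
have le1 X : X \in P -> #|C :&: X| <= 1.
  move=> XP; rewrite leqNgt; apply/negP => CX.
  have sXC : X \subset C.
    apply/setIidPr/eqP; rewrite eqEcard subsetIr (P2 X XP) //.
  have covX : vertex_cover E X.
    apply/forall_inP => S SE; rewrite setIC -card_gt0 EP //.
  by have eXC := minC X covX sXC; move: C3; rewrite -eXC P2.
(* Counting [C] block by block gives [#|P|], so the bounds [le1] are tight on average and hence all
   equalities. *)
have sumC : \sum_(X in P) #|C :&: X| = \sum_(X in P) 1.
  rewrite sum1_card -CP -sum1_card.
  rewrite (eq_bigr (fun X : {set T} => \sum_(x in X) (x \in C : nat))).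
    rewrite -(big_trivIset (R := nat) (idx := 0) (op := addn)) //= covP big_mkcond [RHS]big_mkcond.
    by apply: eq_bigr => x _; rewrite inE; case: (x \in C).
  move=> X _; rewrite -sum1_card big_mkcond [RHS]big_mkcond.
  by apply: eq_bigr => x _; rewrite inE; case: (x \in C); case: (x \in X).
have [_] := leqif_sum (fun X XP => leqif_eq (le1 X XP)).
by rewrite sumC eqxx => /esym /forall_inP eq1 X /eq1 /eqP.
Qed.

Lemma matching_number_ge2 (T : finType) (E : {set {set T}}) :
  2 <= matching_number E ->
  exists S S', [/\ S \in E, S' \in E & [disjoint S & S']].
Proof.
rewrite /matching_number.
have ne : 0 < #|[pred M : {set {set T}} | (M \subset E) && trivIset M]|.
  by apply/card_gt0P; exists set0; rewrite inE sub0set; apply/trivIsetP => A; rewrite inE.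
have [M /andP [/subsetP ME /trivIsetP tM] ->] := eq_bigmax_cond (fun M : {set {set T}} => #|M|) ne.
case/card_gt1P => S [S' [SM S'M nSS']].
by exists S, S'; split; [apply: ME|apply: ME|apply: tM].
Qed.

Lemma covering_number_ge2 (T : finType) (E : {set {set T}}) :
  set0 \notin E -> T -> (forall x, exists2 S : {set T}, S \in E & x \notin S) ->
  2 <= covering_number E.
Proof.
move=> E0 x0 noc; rewrite /covering_number.
(* The default [[set: T]] of the arg min must itself be a cover; it is, as no edge is empty. *)
case: arg_minnP => [|C0 /vertex_coverP covC0 _].
  apply/forall_inP => S SE; rewrite setTI.
  by apply: contraNneq E0 => <-.
rewrite ltnNge; apply/negP => /card_le1_eqP C1.
have [S0 S0E _] := noc x0; have [y yC _] := covC0 _ S0E.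
have [S SE] := noc y; have [z zC zS] := covC0 _ SE.
by rewrite (C1 z y zC yC) zS.
Qed.

Local Open Scope ring_scope.

Lemma rank_incidence_transversal (T : finType) (E : {set {set T}}) (C : {set T}) :
  (3 <= #|C|)%N ->
  (forall x, exists y, [/\ (x \in C) || (y \in C) &
     {in E, forall S : {set T}, (y \in S) = (x \notin S)}]) ->
  (forall c, c \in C -> exists2 S, S \in E & {in C, forall x, (x \in S) = (x == c)}) ->
  (exists S S', [/\ S \in E, S' \in E & [disjoint S & S']]) ->
  \rank (incidence_mx E) = #|C|.+1.
Proof.
move=> C3 partner priv [S [S' [SE S'E dSS']]].
pose A := incidence_mx E.
pose one : 'rV[rat]_#|E| := const_mx 1.
pose AC : 'M[rat]_(#|C|, #|E|) := \matrix_i row (enum_rank (enum_val i)) A.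
pose B := col_mx one AC.
have rowA x y : {in E, forall S : {set T}, (y \in S) = (x \notin S)} ->
    row (enum_rank y) A = one - row (enum_rank x) A.
  move=> xy; apply/rowP => j; rewrite !mxE !enum_rankK xy ?enum_valP //.
  by case: (x \in _); rewrite ?subrr ?subr0.
have rowAC x : x \in C -> (row (enum_rank x) A <= AC)%MS.
  move=> xC; have -> : row (enum_rank x) A = row (enum_rank_in xC x) AC.
    by rewrite rowK enum_rankK_in.
  exact: row_sub.
have oneB : (one <= B)%MS by rewrite -addsmxE addsmxSl.
have ACB : (AC <= B)%MS by rewrite -addsmxE addsmxSr.
(* The row of a vertex outside [C] is [one] minus the row of its partner in [C]; conversely [one] is
   the sum of the rows of any two partners. *)
have eqAB : (A :=: B)%MS.
  apply/eqmxP/andP; split.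
    apply/row_subP => i; rewrite -[i]enum_valK.
    have [y [/orP [xC|yC] xy]] := partner (enum_val i).
      exact: submx_trans (rowAC _ xC) ACB.
    have -> : row (enum_rank (enum_val i)) A = one - row (enum_rank y) A.
      by rewrite (rowA _ _ xy) opprB addrC subrK.
    by rewrite addmx_sub // eqmx_opp (submx_trans (rowAC _ yC)).
  rewrite col_mx_sub; apply/andP; split.
    have [c cC] : exists c, c \in C by apply/card_gt0P; apply: leq_trans C3.
    have [y [_ cy]] := partner c.
    have -> : one = row (enum_rank y) A + row (enum_rank c) A.
      by rewrite (rowA _ _ cy) subrK.
    by rewrite addmx_sub ?row_sub.
  by apply/row_subP => i; rewrite rowK row_sub.
suff freeB : row_free B by rewrite -/A eqAB; apply/eqP.
rewrite -kermx_eq0; apply/rowV0P => u /sub_kermxP.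
rewrite -[u]hsubmxK; set a := lsubmx u; set b := rsubmx u => uB0.
(* This is the entry of [u *m B = 0] in the column of the edge [R]. *)
have rel R (RE : R \in E) : a 0 0 + \sum_i b 0 i * (enum_val i \in R)%:R = 0.
  have /rowP /(_ (enum_rank_in RE R)) := uB0.
  rewrite mul_row_col !mxE big_ord1 !mxE mulr1 => uB0R; rewrite -[RHS]uB0R; congr (_ + _).
  by apply: eq_bigr => i _; rewrite !mxE enum_rankK enum_rankK_in.
have ba i : b 0 i = - a 0 0.
  have [R RE Ri] := priv _ (enum_valP i).
  have := rel R RE; rewrite (bigD1 i) //= Ri ?enum_valP // eqxx mulr1 big1.
    by rewrite addr0 addrC => /eqP; rewrite addr_eq0 => /eqP.
  move=> j nji; rewrite Ri ?enum_valP // (inj_eq enum_val_inj).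
  by rewrite (negPf nji) mulr0.
(* If [x] is not in [S], its partner is in [S], hence not in [S'], which forces [x] into [S']. *)
have SS' x : (x \in S)%:R + (x \in S')%:R = 1 :> rat.
  have [y [_ xy]] := partner x; have := xy _ SE; have := xy _ S'E.
  have [xS|xS] := boolP (x \in S); first by rewrite (disjointFr dSS' xS) addr0.
  move=> yS' yS; move: yS'; rewrite (disjointFr dSS' yS).
  by case: (x \in S') => // _; rewrite add0r.
have a0 : a 0 0 = 0.
  (* In the sum of the relations for [S] and [S'], each element of [C] contributes exactly one
     [- a 0 0]. *)
  have : a 0 0 *+ 2 = a 0 0 *+ #|C|.
    have /eqP := congr2 +%R (rel S SE) (rel S' S'E).
    rewrite addrACA -big_split /= (eq_bigr (fun=> - a 0 0)) => [|i _].
      by rewrite sumr_const card_ord addr0 -mulr2n mulNrn subr_eq0 => /eqP.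
    by rewrite -mulrDr SS' mulr1 ba.
  move/eqP; rewrite -subr_eq0 -opprB oppr_eq0 -mulrnBr ?(ltnW C3) //.
  by rewrite mulrn_eq0 subn_eq0 leqNgt C3 /= => /eqP.
have -> : a = 0 by apply/rowP => i; rewrite !ord1 a0 mxE.
have -> : b = 0 by apply/rowP => i; rewrite ba a0 oppr0 mxE.
exact: row_mx0.
Qed.

Local Close Scope ring_scope.

Theorem proposition3p1 (T : finType) (E : {set {set T}}) (d : nat)
  (hclutter : clutter E)
  (hpart : two_partitionable d E)
  (hcover : exists C : {set T}, [/\ minimal_vertex_cover E C, #|C| = d & 3 <= d])
  (hkonig : konig E) :
  \rank (incidence_mx E) = d.+1.
Proof.
have [_ _ [P [partP cardP P2 EP]]] := hpart.
have [C [minC cardC d3]] := hcover.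
rewrite -cardC in cardP d3 *.
have CX := minimal_cover_transversal partP P2 EP minC (esym cardP) d3.
have partner x : exists y, [/\ (x \in C) || (y \in C) &
     {in E, forall S : {set T}, (y \in S) = (x \notin S)}].
  have /and3P [/eqP covP trivP _] := partP.
  have xP : x \in cover P by rewrite covP inE.
  have XP := pblock_mem xP.
  have [|y [eX xy]] := @partner_exists T E _ x (P2 _ XP) (fun S SE => EP S _ SE XP).
    by rewrite mem_pblock.
  exists y; split=> //.
  have /card_gt0P [z] : 0 < #|C :&: pblock P x| by rewrite CX.
  by rewrite eX !inE => /andP [zC /orP [] /eqP <-]; rewrite zC ?orbT.
have priv c := @minimal_cover_private_edge T E C c minC.
apply: rank_incidence_transversal => //.
apply: matching_number_ge2; rewrite -hkonig.
have [c cC] : exists c, c \in C by apply/card_gt0P; apply: leq_trans d3.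
have [X XP] : exists X, X \in P by apply/card_gt0P; rewrite cardP; apply: leq_trans d3.
apply: covering_number_ge2 => // [|x].
  by apply/negP => /EP /(_ XP); rewrite set0I cards0.
(* An edge avoiding [x]: for [x] in [C], the private edge of another element of [C]; otherwise that
   of the partner of [x], which contains the partner and so not [x]. *)
have [xC|xNC] := boolP (x \in C).
  have /card_gt1P [c1 [c2 [c1C c2C nc]]] : 1 < #|C| by apply: ltnW.
  have [e|n1] := eqVneq x c1.
    by have [S SE SC] := priv _ c2C; exists S; rewrite // SC // e.
  by have [S SE SC] := priv _ c1C; exists S; rewrite // SC.
have [y [+ xy]] := partner x; rewrite (negPf xNC) /= => yC.
by have [S SE SC] := priv _ yC; exists S; rewrite // -xy // SC.
Qed.
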